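(* For every integer $m\geq 8$, the graph $G(m)$ does not belong to the class $\mathfrak{M}$; that is, for no positive integer $t$ does $G(m)$ admit a cyclically-interval $t$-coloring.
   Context: All graphs are undirected, simple, finite and connected. For integers $p\le q$, $[p,q]$ denotes the set of integers from $p$ to $q$; an interval is a nonempty set of consecutive integers. A function $\varphi:E(G)\to[1,t]$ is a proper edge $t$-coloring of a graph $G$ if adjacent edges receive different colors and each of the $t$ colors is used. For a vertex $x$, $S_G(x,\varphi)$ denotes the set of colors of edges incident with $x$. A proper edge $t$-coloring $\varphi$ of $G$ is a cyclically-interval $t$-coloring if for every vertex $x\in V(G)$ at least one of the following holds: (a) $S_G(x,\varphi)$ is an interval; (b) $[1,t]\setminus S_G(x,\varphi)$ is an interval. $\mathfrak{M}_t$ is the set of graphs admitting a cyclically-interval $t$-coloring, and $\mathfrak{M}=\bigcup_{t\ge1}\mathfrak{M}_t$. For an integer $m\geq 2$, the graph $G(m)$ is defined as follows. Its vertex set is $\{x_0\}\cup\{x_{i,j}: 1\le i<j\le m\}\cup\{y_{p,q}: 1\le p\le m,\ 1\le q\le m\}$ (all distinct). Its edge set consists of the edges $(x_0,y_{p,q})$ for all $1\le p,q\le m$, together with, for each pair $1\le i<j\le m$, the edges $(x_{i,j},y_{i,q})$ and $(x_{i,j},y_{j,q})$ for all $1\le q\le m$. *)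

(* Defs.v *)
From mathcomp Require Import all_boot.

Set Implicit Arguments.
Unset Strict Implicit.
Unset Printing Implicit Defensive.

Record graph := Graph {
  vertex :> finType;
  adj : rel vertex;
  adj_sym : symmetric adj;
  adj_irr : irreflexive adj;
  adj_connected : forall u v : vertex, connect adj u v
}.

Definition edge_set (G : graph) : {set {set G}} :=
  [set e | [exists u : G, exists v : G, adj u v && (e == [set u; v])]].

Definition edge (G : graph) : finType := {e : {set G} | e \in edge_set G}.

(** Incidence of [x] with [e] is [x \in val e]. *)

Definition adjacent_edges (G : graph) (e f : edge G) : Prop :=
  e <> f /\ exists x : G, x \in val e /\ x \in val f.

(** Colors are the natural numbers of [[1, t]]; sets of colors are boolean
    predicates on [nat]. *)

Definition segment (p q : nat) : pred nat := [pred c | p <= c <= q].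

Definition interval (A : pred nat) : Prop :=
  exists p q : nat, p <= q /\ A =i segment p q.

Definition proper_edge_coloring (G : graph) (t : nat) (phi : edge G -> nat) :
    Prop :=
  [/\ forall e, phi e \in segment 1 t,
      forall e f, adjacent_edges e f -> phi e <> phi f
    & forall c, c \in segment 1 t -> exists e, phi e = c].

Definition spectrum (G : graph) (x : G) (phi : edge G -> nat) : pred nat :=
  [pred c | [exists e : edge G, (x \in val e) && (phi e == c)]].

Definition cyclically_interval_coloring (G : graph) (t : nat)
    (phi : edge G -> nat) : Prop :=
  proper_edge_coloring t phi /\
  forall x : G,
    interval (spectrum x phi) \/
    interval [predD segment 1 t & spectrum x phi].

Definition in_M_t (t : nat) (G : graph) : Prop :=
  exists phi : edge G -> nat, cyclically_interval_coloring t phi.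

Definition in_M (G : graph) : Prop := exists t : nat, 1 <= t /\ in_M_t t G.

Section GraphG.
Variable m : nat.

(** Indices run over [{0, ..., m-1}] instead of [{1, ..., m}]. The three
    summands are [x_0], the [x_{i,j}] with [i < j], and the [y_{p,q}]. *)
Definition Gvertex : finType :=
  (unit + {ij : 'I_m * 'I_m | ij.1 < ij.2} + 'I_m * 'I_m)%type.

Definition Gx0 : Gvertex := inl (inl tt).
Definition Gx (ij : {ij : 'I_m * 'I_m | ij.1 < ij.2}) : Gvertex :=
  inl (inr ij).
Definition Gy (p q : 'I_m) : Gvertex := inr (p, q).

(** The edges, oriented from the [x]'s to the [y]'s. *)
Definition Garc (u v : Gvertex) : bool :=
  match u, v with
  | inl (inl _), inr _ => true
  | inl (inr ij), inr (p, _) => (p == (val ij).1) || (p == (val ij).2)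
  | _, _ => false
  end.

Definition Gadj : rel Gvertex := [rel u v | Garc u v || Garc v u].

Lemma Gadj_sym : symmetric Gadj.
Proof. by move=> u v; exact: orbC. Qed.

Lemma Gadj_irr : irreflexive Gadj.
Proof. by case=> [[[]|ij]|[p q]]. Qed.

Lemma Gadj_connected (u v : Gvertex) : connect Gadj u v.
Proof.
have y_x0 p q : connect Gadj (Gy p q) Gx0 by exact: connect1.
have to_x0 w : connect Gadj w Gx0.
  case: w => [[[]|ij]|[p q]]; [exact: connect0 | | exact: y_x0].
  apply: connect_trans (y_x0 (val ij).1 (val ij).1).
  by apply: connect1; rewrite /Gadj /Garc /= eqxx.
by apply: connect_trans (to_x0 u) _; rewrite (sym_connect_sym Gadj_sym).
Qed.

Definition Ggraph : graph := Graph Gadj_sym Gadj_irr Gadj_connected.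

End GraphG.

(* Main.v *)
(** Any two edges at [x_0] are joined by a path that crosses one vertex of
    degree [2m] and two of degree [m].  The colors at a vertex of degree [d] lie
    in a cyclic arc of length at most [d], so the colors of the two edges are at
    cyclic distance at most [2(m - 1) + (2m - 1) = 4m - 3].  Thus the [m ^ 2]
    distinct colors at [x_0] lie in a cyclic ball of at most [8m - 5] colors,
    which is fewer than [m ^ 2] when [m >= 8]. *)

Require Import Defs.
From mathcomp Require Import all_boot.
From mathcomp Require Import zify.

(** [a] and [b] are at distance at most [d] in the cyclic group of order [t];
    the shift by [d] avoids negative residues. *)
Definition cyc_near (t d a b : nat) : Prop :=
  exists2 k, k <= d.*2 & a + d = b + k %[mod t].

Lemma cyc_near_trans t d e a b c :
  cyc_near t d a b -> cyc_near t e b c -> cyc_near t (d + e) a c.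
Proof.
move=> [k le_k abk] [l le_l bcl]; exists (k + l); first by lia.
rewrite addnA -modnDml abk modnDml addnAC -modnDml bcl modnDml.
by congr (_ %% _); lia.
Qed.

(** Colors in [[1, t]] are pairwise distinct modulo [t], and the shifted residues [a + d] all occur
    among the [2d + 1] residues [b + k]. *)
Lemma cyc_ball_size t d b (s : seq nat) :
  uniq s -> {subset s <= segment 1 t} ->
  (forall a, a \in s -> cyc_near t d a b) -> size s <= d.*2.+1.
Proof.
move=> uniq_s sub_s near_s.
have inj_s : {in s &, injective (fun a => (a + d) %% t)}.
  move=> a a' /sub_s /andP[a1 at_] /sub_s /andP[a1' at_'] /eqP.
  (* Only the color [t] differs from its own residue, which is 0. *)
  rewrite eqn_modDr; have [->|a_ne] := eqVneq a t.
    rewrite modnn; have [->//|a'_ne] := eqVneq a' t.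
    by rewrite modn_small; lia.
  have [->|a'_ne] := eqVneq a' t; first by rewrite modnn modn_small; lia.
  by rewrite !modn_small; lia.
rewrite -(size_map (fun a => (a + d) %% t)) -(size_iota 0 d.*2.+1).
rewrite -(size_map (fun k => (b + k) %% t) (iota _ _)).
apply: uniq_leq_size; first by rewrite map_inj_in_uniq.
move=> _ /mapP[a /near_s[k le_k ->] ->].
by apply/mapP; exists k; rewrite // mem_iota.
Qed.

(** In both cases [A] is an arc of the cycle of colors. As [A] is a mere predicate, its number of
    elements is bounded through a list [s] covering it. *)
Lemma cyc_arc_near t (A : pred nat) (s : seq nat) :
  {subset A <= segment 1 t} -> {subset A <= s} ->
  interval A \/ interval [predD segment 1 t & A] ->
  {in A &, forall a b, cyc_near t (size s).-1 a b}.
Proof.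
move=> sub_t sub_s [[p [q [le_pq defA]]]|[p [q [le_pq defC]]]] a b Aa Ab.
  have : size (iota p (q - p).+1) <= size s.
    apply: uniq_leq_size (iota_uniq _ _) _ => c; rewrite mem_iota => c_pq.
    by apply: sub_s; rewrite defA inE; lia.
  rewrite size_iota => le_s.
  move: Aa Ab; rewrite !defA !inE => a_pq b_pq.
  by exists (a + (size s).-1 - b); [lia | congr (_ %% _); lia].
have inA c : 1 <= c <= t -> (c \in A) = ~~ (p <= c <= q).
  by move=> c_t; have := defC c; rewrite !inE c_t andbT => <-; rewrite negbK.
have [p_t q_t] : 1 <= p <= t /\ 1 <= q <= t.
  have := defC p; have := defC q; rewrite !inE !leqnn le_pq.
  by move=> /andP[_ ->] /andP[_ ->].
(* Here [A] consists of the two ends of [[1, t]] left by the gap [[p, q]]. *)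
have : size (iota 1 p.-1 ++ iota q.+1 (t - q)) <= size s.
  apply: uniq_leq_size => [|c].
    rewrite cat_uniq !iota_uniq andbT /=; apply/hasPn => c.
    by rewrite !mem_iota; lia.
  by rewrite mem_cat !mem_iota => c_pq; apply: sub_s; rewrite inA; lia.
rewrite size_cat !size_iota => le_s.
have /andP[a1 a_t] := sub_t _ Aa; have /andP[b1 b_t] := sub_t _ Ab.
move: Aa Ab; rewrite !inA ?a1 ?b1 // => a_pq b_pq.
(* Colors on opposite sides of the gap are joined through [t]: the smaller one is raised by [t],
   which makes the two ends contiguous. *)
have [a_p|p_a] := ltnP a p; have [b_p|p_b] := ltnP b p.
- by exists (a + (size s).-1 - b); [lia | congr (_ %% _); lia].
- exists (a + t + (size s).-1 - b); first by lia.
  by rewrite -(modnDr (a + _)); congr (_ %% _); lia.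
- exists (a + (size s).-1 - (b + t)); first by lia.
  by rewrite -(modnDr (b + _)); congr (_ %% _); lia.
- by exists (a + (size s).-1 - b); [lia | congr (_ %% _); lia].
Qed.

Section Coloring.
Variable G : graph.

Lemma edge_of_adj (u v : G) : adj u v -> [set u; v] \in edge_set G.
Proof.
by move=> uv; rewrite inE; apply/existsP; exists u; apply/existsP; exists v;
   rewrite uv eqxx.
Qed.

Definition edge_between (u v : G) (uv : adj u v) : edge G :=
  exist _ [set u; v] (edge_of_adj u v uv).

Lemma card_incident (v : G) :
  #|[pred e : edge G | v \in val e]| <= #|adj v|.
Proof.
rewrite -(card_image val_inj).
apply: leq_trans (leq_image_card (fun w => [set v; w]) (adj v)).
apply/subset_leq_card/subsetP => _ /imageP[e v_e ->].
have := valP e; rewrite inE => /existsP[u /existsP[w /andP[uw /eqP def_e]]].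
move: v_e; rewrite inE def_e in_set2 => /orP[] /eqP->; apply/imageP.
  by exists w.
by exists u; [move: uw; rewrite adj_sym | rewrite setUC].
Qed.

Variables (t : nat) (phi : edge G -> nat).
Hypothesis phiP : cyclically_interval_coloring t phi.

(** The spectrum at [v] is an arc with at most [d + 1] colors, so any two of them are at most [d]
    steps apart. *)
Lemma incident_colors_near d (v : G) (e f : edge G) :
  #|adj v| <= d.+1 -> v \in val e -> v \in val f ->
  cyc_near t d (phi e) (phi f).
Proof.
move=> deg_v v_e v_f; have [[phi_t _ _] phi_int] := phiP.
pose s := [seq phi g | g in [pred g : edge G | v \in val g]].
have size_s : size s <= d.+1 by rewrite size_image (leq_trans (card_incident v)).
have in_spec (g : edge G) : v \in val g -> phi g \in spectrum v phi.
  by move=> v_g; apply/existsP; exists g; rewrite v_g eqxx.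
have sub_t : {subset spectrum v phi <= segment 1 t}.
  by move=> _ /existsP[g /andP[_ /eqP <-]].
have sub_s : {subset spectrum v phi <= s}.
  by move=> _ /existsP[g /andP[v_g /eqP <-]]; apply: image_f.
have [k le_k efk] := cyc_arc_near _ _ _ sub_t sub_s (phi_int v) _ _
  (in_spec _ v_e) (in_spec _ v_f).
(* The shift built into [cyc_near] grows from [(size s).-1] to [d], and [k] grows by the same
   amount. *)
exists (k + (d - (size s).-1)); first by lia.
by rewrite addnA -[RHS]modnDml -efk modnDml; congr (_ %% _); lia.
Qed.

End Coloring.

Section GraphG.
Variable m : nat.

(** A neighbor [x_{i,j}] is determined by its index other than [p]; this leaves the value [p] free
    for [x_0]. *)
Lemma deg_Gy (p q : 'I_m) : #|@Gadj m (Gy p q)| <= m.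
Proof.
pose other (v : Gvertex m) : 'I_m :=
  if v is inl (inr ij) then
    if (val ij).1 == p then (val ij).2 else (val ij).1
  else p.
rewrite -[leqRHS]card_ord; apply: (leq_card_in other).
case=> [[[]|[[i j] /= ij]]|[? ?]] //; case=> [[[]|[[k l] /= kl]]|[? ?]] //;
  rewrite !unfold_in /Gadj /Garc /= => u_p v_p /(congr1 (@nat_of_ord m)).
- by move: v_p; rewrite -!val_eqE /=; case: ifP; lia.
- by move: u_p; rewrite -!val_eqE /=; case: ifP; lia.
move=> eq_o; suff [/val_inj eq_i /val_inj eq_j] : i = k :> nat /\ j = l :> nat.
  by congr (inl (inr _)); apply: val_inj; rewrite /= eq_i eq_j.
by move: eq_o u_p v_p; rewrite -!val_eqE /=; do 2 case: ifP; lia.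
Qed.

Lemma deg_Gx (ij : {ij : 'I_m * 'I_m | ij.1 < ij.2}) :
  #|@Gadj m (Gx ij)| <= m.*2.
Proof.
pose nbr (bq : bool * 'I_m) : Gvertex m :=
  Gy (if bq.1 then (val ij).1 else (val ij).2) bq.2.
have -> : m.*2 = #|[set: bool * 'I_m]|.
  by rewrite cardsT card_prod card_bool card_ord mul2n.
apply: leq_trans (leq_image_card nbr _).
apply/subset_leq_card/subsetP => -[[[]|?]|[p q]] //.
rewrite unfold_in /Gadj /Garc /= orbF => /orP[] /eqP->; apply/imageP.
  by exists (true, q); rewrite ?inE.
by exists (false, q); rewrite ?inE.
Qed.

Lemma Gx_of_pair (p r : 'I_m) : p != r ->
  exists x, forall q, @Gadj m (Gx x) (Gy p q) /\ Gadj (Gx x) (Gy r q).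
Proof.
rewrite neq_ltn => /orP[] lt_pr.
  by exists (Sub (p, r) lt_pr) => q; rewrite /Gadj /Garc /= !eqxx orbT.
by exists (Sub (r, p) lt_pr) => q; rewrite /Gadj /Garc /= !eqxx orbT.
Qed.

(** The choice of [x] is independent of [q], so it serves two [y]-vertices with different second
    indices. If [p = r], any second row completes the pair. *)
Lemma Gy_common_nbr (hm : 1 < m) (p r : 'I_m) :
  exists x, forall q, @Gadj m (Gx x) (Gy p q) /\ Gadj (Gx x) (Gy r q).
Proof.
have [<-|] := eqVneq p r; last exact: Gx_of_pair.
have [s ne_ps] : exists s, p != s.
  pose o k (lt_k : k < m) := Ordinal lt_k.
  have [p0|] := eqVneq p (o 0 (ltnW hm)); last by exists (o 0 (ltnW hm)).
  by exists (o 1 hm); rewrite p0.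
by have [x x_adj] := Gx_of_pair _ _ ne_ps; exists x => q; have [] := x_adj q.
Qed.

Definition x0_edge (pq : 'I_m * 'I_m) : edge (Ggraph m) :=
  edge_between (Ggraph m) (Gx0 m) (Gy pq.1 pq.2) isT.

Lemma x0_edge_inj : injective x0_edge.
Proof.
move=> [p q] [p' q'] /(congr1 val) /= /setP/(_ (Gy p q)).
by rewrite !in_set2 eqxx orbT => /esym/eqP[-> ->].
Qed.

Lemma x0_edge_near t (phi : edge (Ggraph m) -> nat) (pq rs : 'I_m * 'I_m) :
  1 < m -> cyclically_interval_coloring t phi ->
  cyc_near t (4 * m - 3) (phi (x0_edge pq)) (phi (x0_edge rs)).
Proof.
case: pq rs => [p q] [r s] m_gt1 phiP.
have [x x_adj] := Gy_common_nbr m_gt1 p r.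
have [xp _] := x_adj q; have [_ xr] := x_adj s.
pose ep : edge (Ggraph m) := edge_between (Ggraph m) _ _ xp.
pose er : edge (Ggraph m) := edge_between (Ggraph m) _ _ xr.
(* The summands are the costs of passing through [y_{p,q}], [x] and [y_{r,s}], each being the degree
   bound minus one. *)
have -> : 4 * m - 3 = m.-1 + m.*2.-1 + m.-1 by lia.
apply: (cyc_near_trans _ _ _ _ (phi er)).
  apply: (cyc_near_trans _ _ _ _ (phi ep)).
    apply: (incident_colors_near _ _ _ phiP _ (Gy p q)).
    - by rewrite prednK ?deg_Gy //; lia.
    - by rewrite in_set2 eqxx orbT.
    - by rewrite in_set2 eqxx orbT.
  apply: (incident_colors_near _ _ _ phiP _ (Gx x)).
  - by rewrite prednK ?deg_Gx //; lia.
  - by rewrite in_set2 eqxx.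
  - by rewrite in_set2 eqxx.
apply: (incident_colors_near _ _ _ phiP _ (Gy r s)).
- by rewrite prednK ?deg_Gy //; lia.
- by rewrite in_set2 eqxx orbT.
- by rewrite in_set2 eqxx orbT.
Qed.

End GraphG.

Theorem theorem1 (m : nat) (hm : 8 <= m) : ~ in_M (Ggraph m).
Proof.
case=> t [_ [phi phiP]]; have [[phi_t phi_proper _] _] := phiP.
have m_gt1 : 1 < m by apply: leq_trans hm.
pose o : 'I_m := Ordinal (ltnW m_gt1).
(* All these edges meet at [x_0], so properness separates their colors. *)
have phi_inj : injective (fun pq : 'I_m * 'I_m => phi (x0_edge m pq)).
  move=> pq rs eq_phi; have [//|ne] := eqVneq pq rs.
  case: (phi_proper (x0_edge m pq) (x0_edge m rs)) => //; split.
    by move/x0_edge_inj/eqP; rewrite (negPf ne).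
  by exists (Gx0 m); rewrite !in_set2 eqxx.
have := @cyc_ball_size t (4 * m - 3) (phi (x0_edge m (o, o)))
  [seq phi (x0_edge m pq) | pq : 'I_m * 'I_m].
rewrite size_image card_prod card_ord => le_size.
have : m * m <= (4 * m - 3).*2.+1.
  apply: le_size; first by rewrite map_inj_uniq ?enum_uniq.
  - by move=> _ /imageP[pq _ ->].
  - by move=> _ /imageP[pq _ ->]; apply: x0_edge_near.
(* The bound reads [m * m <= 8 * m - 5], which already fails at [m = 8], where 64 exceeds 59. *)
by nia.
Qed.
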